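(* Let $e\in\mathbb{R}^n$, $f\in\mathbb{R}^m$, and let $\mathcal{A}\colon\mathbb{R}^{m\times n}\to\mathbb{R}^{m+n}$, $T\mapsto\begin{bmatrix}Te\\ T^{\intercal}f\end{bmatrix}$. Let $r\in\mathbb{R}^n$, let $s\in\mathbb{R}^m$, and let $\bar{s}\in\mathbb{R}^m$ and $\bar{r}\in\mathbb{R}^n$ be defined by $\begin{bmatrix}\bar{s}\\ \bar{r}\end{bmatrix}=P_{\operatorname{ran}\mathcal{A}}\begin{bmatrix}s\\ r\end{bmatrix}$. Then $$C:=\{T\in\mathbb{R}^{m\times n} : Te=\bar{s}\text{ and }T^{\intercal}f=\bar{r}\}\neq\varnothing.$$ Now let $T\in\mathbb{R}^{m\times n}$. If $e\neq 0$ and $f\neq 0$, then $$P_C(T)=T-\frac{1}{\|e\|^2}\Big((Te-s)e^{\intercal}-\frac{f^{\intercal}(Te-s)}{\|e\|^2+\|f\|^2}\,fe^{\intercal}\Big)-\frac{1}{\|f\|^2}\Big(f(f^{\intercal}T-r^{\intercal})-\frac{e^{\intercal}(T^{\intercal}f-r)}{\|e\|^2+\|f\|^2}\,fe^{\intercal}\Big).$$ Moreover, $$P_C(T)=\begin{cases}T-\dfrac{1}{\|f\|^2}\,f(f^{\intercal}T-r^{\intercal}), & \text{if } e=0\text{ and } f\neq 0;\\[2mm] T-\dfrac{1}{\|e\|^2}\,(Te-s)e^{\intercal}, & \text{if } e\neq 0\text{ and } f=0;\\[2mm] T, & \text{if } e=0\text{ and } f=0.\end{cases}$$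
   Context: $\mathbb{R}^{m\times n}$ is the space of real $m\times n$ matrices with the Frobenius inner product $\langle S,T\rangle=\operatorname{trace}(S^{\intercal}T)$; $\mathbb{R}^n$, $\mathbb{R}^m$, $\mathbb{R}^{m+n}$ carry the Euclidean inner product with norm $\|\cdot\|$. For a nonempty closed convex subset $D$ of a Euclidean space, $P_D$ denotes the orthogonal (nearest-point) projection onto $D$. *)

(* Defs.v *)
From HB Require Import structures.
From mathcomp Require Import all_boot all_order all_algebra.
From mathcomp Require Import boolp classical_sets reals.
Set Implicit Arguments.
Unset Strict Implicit.
Unset Printing Implicit Defensive.
Import Order.TTheory GRing.Theory Num.Theory.
Local Open Scope classical_set_scope.
Local Open Scope ring_scope.

(* Column vectors are p x 1 matrices, for which the Frobenius inner product    *)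
(* and norm are the Euclidean ones.                                            *)
Definition frob_dot (R : realType) (p q : nat) (S T : 'M[R]_(p, q)) : R :=
  \tr (S^T *m T).

Definition frob_norm (R : realType) (p q : nat) (S : 'M[R]_(p, q)) : R :=
  Num.sqrt (frob_dot S S).

Definition is_nearest_point (R : realType) (p q : nat)
    (D : set 'M[R]_(p, q)) (x y : 'M[R]_(p, q)) : Prop :=
  D y /\ forall z, D z -> frob_norm (x - y) <= frob_norm (x - z).

(* The nearest point exists and is unique when D is nonempty, closed and       *)
(* convex; the value 0 is a dummy, used only when D has no point nearest to x. *)
Definition orth_proj (R : realType) (p q : nat)
    (D : set 'M[R]_(p, q)) (x : 'M[R]_(p, q)) : 'M[R]_(p, q) :=
  xget 0 [set y | is_nearest_point D x y].

Definition marginal_map (R : realType) (m n : nat) (e : 'cV[R]_n) (f : 'cV[R]_m)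
    (T : 'M[R]_(m, n)) : 'cV[R]_(m + n) :=
  col_mx (T *m e) (T^T *m f).

Definition marginal_set (R : realType) (m n : nat) (e : 'cV[R]_n) (f : 'cV[R]_m)
    (sbar : 'cV[R]_m) (rbar : 'cV[R]_n) : set 'M[R]_(m, n) :=
  [set T | T *m e = sbar /\ T^T *m f = rbar].

(* Main.v *)
Require Import Defs.
From HB Require Import structures.
From mathcomp Require Import all_boot all_order all_algebra.
From mathcomp Require Import boolp classical_sets reals.
From mathcomp Require Import ring.
Set Implicit Arguments.
Unset Strict Implicit.
Unset Printing Implicit Defensive.
Import Order.TTheory GRing.Theory Num.Theory.
Local Open Scope classical_set_scope.
Local Open Scope ring_scope.

(** Let A be the map sending T to (T e, T^T f).  Its adjoint sends (u, v) to
    u e^T + f v^T ([frob_dot_marginal_map]).  Two facts of linear algebra then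
    characterise every projection in the theorem ([orth_proj_eq]): A y is the
    projection of (s, r) on the range of A as soon as y solves the normal
    equation A^*(A y - (s, r)) = 0, and such a y is the projection of T on the
    fibre of A through y as soon as T - y lies in the range of A^*.  So it
    suffices to exhibit one y with both properties
    ([orth_proj_marginal_set]), and its existence also shows that the fibre is
    nonempty.

    The candidate is y = T - u e^T - f v^T with the multipliers u and v read
    off the announced formula.  Write p = T e - s, q = T^T f - r and
    c = (f^T p - e^T q) / (|e|^2 + |f|^2).  For nonzero e and f a direct
    computation gives y e - s = c f, and, by the symmetry that transposes T
    and exchanges the two constraints, y^T f - r = - c e; the two terms of
    the normal equation are therefore c f e^T and its opposite.
    Because 0^-1 = 0, the multiplier of a zero vector is zero, so that the same
    formula and the same normal equation cover the degenerate cases too. *)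

(** * The Frobenius inner product and projections *)

Section Frobenius.
Variables (R : realType) (p q : nat).
Implicit Types (S T U : 'M[R]_(p, q)) (D : set 'M[R]_(p, q)).

Lemma frob_dotE S T : frob_dot S T = \sum_j \sum_i S i j * T i j.
Proof.
rewrite /frob_dot /mxtrace; apply: eq_bigr => j _.
by rewrite mxE; apply: eq_bigr => i _; rewrite mxE.
Qed.

Lemma frob_dotC S T : frob_dot S T = frob_dot T S.
Proof. by rewrite /frob_dot -mxtrace_tr trmx_mul trmxK. Qed.

Lemma frob_dotDl S T U : frob_dot (S + T) U = frob_dot S U + frob_dot T U.
Proof. by rewrite /frob_dot linearD mulmxDl mxtraceD. Qed.

Lemma frob_dotDr S T U : frob_dot S (T + U) = frob_dot S T + frob_dot S U.
Proof. by rewrite /frob_dot mulmxDr mxtraceD. Qed.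

Lemma frob_dot0l T : frob_dot 0 T = 0.
Proof. by rewrite /frob_dot trmx0 mul0mx mxtrace0. Qed.

Lemma frob_dot_ge0 S : 0 <= frob_dot S S.
Proof.
by rewrite frob_dotE; apply: sumr_ge0 => j _; apply: sumr_ge0 => i _; apply: sqr_ge0.
Qed.

Lemma frob_dot_eq0 S : (frob_dot S S == 0) = (S == 0).
Proof.
apply/idP/eqP => [|->]; last by rewrite frob_dot0l.
have col_ge0 j : 0 <= \sum_i S i j * S i j.
  by apply: sumr_ge0 => i _; apply: sqr_ge0.
rewrite frob_dotE psumr_eq0 // => /allP S0.
apply/matrixP => i j; rewrite mxE.
have := S0 j (mem_index_enum j); rewrite psumr_eq0; last by move=> k _; apply: sqr_ge0.
by move=> /allP/(_ i (mem_index_enum i)); rewrite /= mulf_eq0 orbb => /eqP.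
Qed.

Lemma frob_norm_sqr S : frob_norm S ^+ 2 = frob_dot S S.
Proof. by rewrite /frob_norm sqr_sqrtr // frob_dot_ge0. Qed.

Lemma pythagoras S T :
  frob_dot S T = 0 -> frob_dot (S + T) (S + T) = frob_dot S S + frob_dot T T.
Proof.
by move=> ST; rewrite frob_dotDl !frob_dotDr [frob_dot T S]frob_dotC ST addr0 add0r.
Qed.

(** By the theorem of Pythagoras, |x - z|^2 = |x - y|^2 + |y - z|^2, so y is
    a nearest point, and any other point of D is strictly further away. *)
Lemma orth_proj_eq D x y :
  D y -> (forall z, D z -> frob_dot (x - y) (y - z) = 0) -> orth_proj D x = y.
Proof.
move=> Dy orth.
have pyth z : D z ->
    frob_dot (x - z) (x - z) = frob_dot (x - y) (x - y) + frob_dot (y - z) (y - z).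
  by move=> /orth xyz; rewrite -pythagoras // addrA subrK.
have near_y : is_nearest_point D x y.
  split=> // z Dz; rewrite /frob_norm ler_wsqrtr // (pyth _ Dz).
  by rewrite lerDl frob_dot_ge0.
rewrite /orth_proj; case: xgetP => [w _ [Dw near_w]|/(_ y)]; last by case.
have := near_w y Dy; rewrite /frob_norm ler_sqrt ?frob_dot_ge0 // (pyth _ Dw).
rewrite gerDl => dyw.
apply/esym/eqP; rewrite -subr_eq0 -frob_dot_eq0.
by apply/eqP/le_anti; rewrite dyw frob_dot_ge0.
Qed.

End Frobenius.

Lemma frob_dot_col_mx (R : realType) (m n q : nat) (a c : 'M[R]_(m, q))
    (b d : 'M[R]_(n, q)) :
  frob_dot (col_mx a b) (col_mx c d) = frob_dot a c + frob_dot b d.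
Proof. by rewrite /frob_dot tr_col_mx mul_row_col mxtraceD. Qed.

Lemma trmx_mul_self (R : realType) (n : nat) (e : 'cV[R]_n) :
  e^T *m e = (frob_norm e ^+ 2)%:M.
Proof. by rewrite [LHS]mx11_scalar frob_norm_sqr /frob_dot trace_mx11. Qed.

Lemma frob_norm_sqr_eq0 (R : realType) (n : nat) (e : 'cV[R]_n) :
  (frob_norm e ^+ 2 == 0) = (e == 0).
Proof. by rewrite frob_norm_sqr frob_dot_eq0. Qed.

(** * The normal equation of the marginal map *)

Section Marginals.
Variables (R : realType) (m n : nat).
Implicit Types (e r v : 'cV[R]_n) (f s u : 'cV[R]_m) (T y : 'M[R]_(m, n)).

(** The adjoint of T |-> (T e, T^T f) is (u, v) |-> u e^T + f v^T. *)
Lemma frob_dot_marginal_map e f u v T :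
  frob_dot (col_mx u v) (marginal_map e f T) = frob_dot (u *m e^T + f *m v^T) T.
Proof.
rewrite frob_dot_col_mx frob_dotDl /frob_dot !trmx_mul !trmxK; congr (_ + _).
  by rewrite mulmxA mxtrace_mulC mulmxA.
by rewrite -mxtrace_tr !trmx_mul !trmxK mxtrace_mulC mulmxA.
Qed.

Lemma marginal_mapB e f T y :
  marginal_map e f (T - y) = marginal_map e f T - marginal_map e f y.
Proof. by rewrite /marginal_map linearB !mulmxBl opp_col_mx add_col_mx. Qed.

(** The normal equation makes A y the projection of (s, r) on the range of A,
    which identifies the fibre C as {z | A z = A y}; the residual T - y is then
    orthogonal to the directions y - z of C, because these lie in the kernel
    of A and the residual in the range of the adjoint. *)
Lemma orth_proj_marginal_set e f s r sbar rbar u v T y :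
    col_mx sbar rbar = orth_proj (range (marginal_map e f)) (col_mx s r) ->
    (y *m e - s) *m e^T + f *m (y^T *m f - r)^T = 0 ->
    T - y = u *m e^T + f *m v^T ->
  marginal_set e f sbar rbar y /\ orth_proj (marginal_set e f sbar rbar) T = y.
Proof.
move=> hbar normal_eq residual.
have Ay : col_mx sbar rbar = marginal_map e f y.
  rewrite hbar; apply: orth_proj_eq => [|_ [z _ <-]]; first by exists y.
  rewrite -marginal_mapB {1}/marginal_map opp_col_mx add_col_mx frob_dot_marginal_map.
  rewrite -(opprB (y *m e)) -(opprB (y^T *m f)) linearN /= mulNmx mulmxN -opprD.
  by rewrite normal_eq oppr0 frob_dot0l.
have Cy : marginal_set e f sbar rbar y by case/eq_col_mx: Ay => -> ->.
split=> //; apply: orth_proj_eq => // z [ze zf].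
rewrite residual -frob_dot_marginal_map marginal_mapB -Ay /marginal_map ze zf.
by rewrite subrr frob_dotC frob_dot0l.
Qed.

End Marginals.

(** * The explicit solution *)

(** The vector u for which the formula of the theorem subtracts u e^T from T;
    the vector v of the other subtracted term f v^T is the same expression
    for the transposed data. *)
Definition multiplier (R : realType) (m n : nat) (e : 'cV[R]_n) (f s : 'cV[R]_m)
    (T : 'M[R]_(m, n)) : 'cV[R]_m :=
  (frob_norm e ^+ 2)^-1 *:
    (T *m e - s
     - ((f^T *m (T *m e - s)) 0 0 / (frob_norm e ^+ 2 + frob_norm f ^+ 2)) *: f).

Definition marginal_proj (R : realType) (m n : nat) (e r : 'cV[R]_n)
    (f s : 'cV[R]_m) (T : 'M[R]_(m, n)) : 'M[R]_(m, n) :=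
  T - multiplier e f s T *m e^T - f *m (multiplier f e r T^T)^T.

Lemma multiplier0 (R : realType) (m n : nat) (f s : 'cV[R]_m) (T : 'M[R]_(m, n)) :
  multiplier 0 f s T = 0.
Proof.
by rewrite /multiplier (eqP (etrans (frob_norm_sqr_eq0 _) (eqxx 0))) invr0 scale0r.
Qed.

(** The left side of the identity is one of the two terms of the normal
    equation; its right side changes sign when the data are transposed.
    The factor e^T makes the identity hold for every e: when e = 0, y e - s
    is - s, which need not be a multiple of f. *)
Lemma marginal_proj_residual (R : realType) (m n : nat) (e r : 'cV[R]_n)
    (f s : 'cV[R]_m) (T : 'M[R]_(m, n)) :
  (marginal_proj e r f s T *m e - s) *m e^T =
    (((f^T *m (T *m e - s)) 0 0 - (e^T *m (T^T *m f - r)) 0 0)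
      / (frob_norm e ^+ 2 + frob_norm f ^+ 2)) *: (f *m e^T).
Proof.
have [->|e0] := eqVneq e 0; first by rewrite trmx0 !mulmx0 scaler0.
rewrite scalemxAl; congr (_ *m _).
rewrite /marginal_proj !mulmxBl -!mulmxA trmx_mul_self mul_mx_scalar.
have a0 : frob_norm e ^+ 2 != 0 by rewrite frob_norm_sqr_eq0.
rewrite {1}/multiplier scalerA mulfV // scale1r.
set p := T *m e - s; set xi := (f^T *m p) 0 0.
have [->|f0] := eqVneq f 0.
  by rewrite mul0mx !scaler0 !subr0 addrAC subrr.
have b0 : frob_norm f ^+ 2 != 0 by rewrite frob_norm_sqr_eq0.
have c0 : frob_norm e ^+ 2 + frob_norm f ^+ 2 != 0.
  by rewrite lt0r_neq0 // ltr_wpDl ?sqr_ge0 // lt_def b0 sqr_ge0.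
(* The second multiplier only enters through its inner product with e. *)
have -> : (multiplier f e r T^T)^T *m e
    = ((e^T *m (T^T *m f - r)) 0 0 / (frob_norm e ^+ 2 + frob_norm f ^+ 2))%:M.
  set eta := (e^T *m _) 0 0.
  rewrite -[LHS]trmxK trmx_mul trmxK /multiplier -/eta -scalemxAr mulmxBr -scalemxAr.
  rewrite trmx_mul_self [e^T *m (_ - r)]mx11_scalar -/eta !scale_scalar_mx.
  rewrite -raddfB /= scale_scalar_mx tr_scalar_mx.
  congr _%:M; rewrite [frob_norm f ^+ 2 + _]addrC.
  move: (frob_norm e ^+ 2) (frob_norm f ^+ 2) b0 c0 => a b b0 c0.
  by field; rewrite b0 c0.
rewrite mul_mx_scalar mulrBl scalerBl -/xi /p.
by move: (T *m e) => Te; apply/matrixP => i j; rewrite !mxE; ring.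
Qed.

Lemma trmx_marginal_proj (R : realType) (m n : nat) (e r : 'cV[R]_n)
    (f s : 'cV[R]_m) (T : 'M[R]_(m, n)) :
  (marginal_proj e r f s T)^T = marginal_proj f s e r T^T.
Proof.
rewrite /marginal_proj !linearB /= !trmx_mul !trmxK -!addrA; congr (_ + _).
by rewrite addrC.
Qed.

Lemma marginal_proj_normal_eq (R : realType) (m n : nat) (e r : 'cV[R]_n)
    (f s : 'cV[R]_m) (T : 'M[R]_(m, n)) :
  (marginal_proj e r f s T *m e - s) *m e^T
    + f *m ((marginal_proj e r f s T)^T *m f - r)^T = 0.
Proof.
(* Both terms are values of the residual identity, the second one after
   transposition. *)
rewrite -[f *m _]trmxK trmx_mul trmxK trmx_marginal_proj !marginal_proj_residual.
rewrite linearZ /= trmx_mul !trmxK -scalerDl [frob_norm f ^+ 2 + _]addrC -mulrDl.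
by rewrite -opprB addNr mul0r scale0r.
Qed.

Theorem theorem3p3 (R : realType) (m n : nat) (e : 'cV[R]_n) (f : 'cV[R]_m)
    (r : 'cV[R]_n) (s : 'cV[R]_m) (sbar : 'cV[R]_m) (rbar : 'cV[R]_n)
    (hbar : col_mx sbar rbar
            = orth_proj (range (@marginal_map R m n e f)) (col_mx s r)) :
  let C := marginal_set e f sbar rbar in
  C !=set0 /\
  forall T : 'M[R]_(m, n),
    [/\ e != 0 -> f != 0 ->
        orth_proj C T =
          T
          - (frob_norm e ^+ 2)^-1 *:
              ((T *m e - s) *m e^T
               - ((f^T *m (T *m e - s)) 0 0
                  / (frob_norm e ^+ 2 + frob_norm f ^+ 2)) *: (f *m e^T))
          - (frob_norm f ^+ 2)^-1 *:
              (f *m (f^T *m T - r^T)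
               - ((e^T *m (T^T *m f - r)) 0 0
                  / (frob_norm e ^+ 2 + frob_norm f ^+ 2)) *: (f *m e^T)),
        e = 0 -> f != 0 ->
        orth_proj C T =
          T - (frob_norm f ^+ 2)^-1 *: (f *m (f^T *m T - r^T)),
        e != 0 -> f = 0 ->
        orth_proj C T =
          T - (frob_norm e ^+ 2)^-1 *: ((T *m e - s) *m e^T)
      & e = 0 -> f = 0 -> orth_proj C T = T].
Proof.
move=> C; have proj T : C (marginal_proj e r f s T)
    /\ orth_proj C T = marginal_proj e r f s T.
  apply: (orth_proj_marginal_set hbar (marginal_proj_normal_eq e r f s T)).
  by rewrite /marginal_proj -addrA -opprD opprB addrC subrK.
split=> [|T]; first by exists (marginal_proj e r f s 0); case: (proj 0).
have {proj} [_ ->] := proj T; rewrite /marginal_proj.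
have fv : f *m (multiplier f e r T^T)^T = (frob_norm f ^+ 2)^-1 *:
    (f *m (f^T *m T - r^T)
     - ((e^T *m (T^T *m f - r)) 0 0
        / (frob_norm e ^+ 2 + frob_norm f ^+ 2)) *: (f *m e^T)).
  rewrite /multiplier [frob_norm f ^+ 2 + _]addrC [(_ *: _)^T]linearZ /= -scalemxAr.
  congr (_ *: _); rewrite [(_ - _ *: e)^T]linearB /= [(_ *: e)^T]linearZ /=.
  by rewrite [(_ - r)^T]linearB /= trmx_mul trmxK mulmxBr -scalemxAr.
have ue : multiplier e f s T *m e^T = (frob_norm e ^+ 2)^-1 *:
    ((T *m e - s) *m e^T
     - ((f^T *m (T *m e - s)) 0 0
        / (frob_norm e ^+ 2 + frob_norm f ^+ 2)) *: (f *m e^T)).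
  by rewrite /multiplier -scalemxAl mulmxBl -scalemxAl.
split=> [_ _|e0 _|_ f0|e0 f0].
- by rewrite ue fv.
- by rewrite fv e0 multiplier0 !trmx0 !mulmx0 scaler0 !subr0.
- by rewrite ue f0 mul0mx multiplier0 !mul0mx scaler0 !subr0.
- by rewrite e0 f0 trmx0 mulmx0 mul0mx !subr0.
Qed.
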